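(* Let $\mathbb{X}$ be a Cartesian tangent category with a differential curve object $C$. If $q:A\to M$ and $q':B\to M'$ are differential bundles and $f:A\to B$ is a bundle morphism between them (i.e. $fq'=qg$ for some $g:M\to M'$), then $f$ is linear if and only if $f$ preserves the actions associated to $A$ and $B$, that is, if and only if $\gamma^A f=(1\times f)\gamma^B:C\times A\to B$.
   Context: Composition is written in diagrammatic order: $fg$ means first $f$, then $g$. A tangent category is a category $\mathbb{X}$ with a functor $T:\mathbb{X}\to\mathbb{X}$ and natural transformations $p:T\to 1$, $0:1\to T$, $+:T_2\to T$, $\ell:T\to T^2$, $c:T^2\to T^2$ such that: (1) for all $M,n$ the fibre power $T_nM$ of $n$ copies of $p_M:TM\to M$ exists and is preserved by every $T^k$; (2) $(p_M,+_M,0_M)$ is an additive bundle, i.e. a commutative monoid in $\mathbb{X}/M$; (3) $(\ell_M,0_M)$ is an additive bundle morphism (commuting square preserving addition and zero) from $(p_M,+_M,0_M)$ to $(T(p_M),T(+_M),T(0_M))$, and $(c_M,1_{TM})$ is one from $(T(p_M),T(+_M),T(0_M))$ to $(p_{TM},+_{TM},0_{TM})$; (4) $cc=1$, $\ell c=\ell$, $\ell T(\ell)=\ell\ell_T$, $T(c)c_TT(c)=c_TT(c)c_T$, $\ell_TT(c)c_T=cT(\ell)$; (5) with $v:=\langle\pi_0\ell,\pi_10_{TM}\rangle T(+):T_2M\to T^2M$, the square $vT(p)=\pi_0p0$ exhibits $T_2M$ as the pullback of $T(p_M)$ along $0_M$, and this pullback is preserved by every $T^k$. It is Cartesian if it has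 finite products (terminal object $1$, unique maps to it written $!$) and $T$ preserves them; $T(A\times B)$ is identified with $TA\times TB$. Object subscripts are often omitted. Differential bundles. A differential bundle $(q:A\to M,\lambda,\sigma,\zeta)$ is an additive bundle $(q,\sigma:A_2\to A,\zeta:M\to A)$ whose fibre powers $A_n$ exist and are preserved by every $T^k$, with a lift $\lambda:A\to TA$ such that $(\lambda,0_M)$ is an additive bundle morphism from $(q,\sigma,\zeta)$ to $(T(q),T(\sigma),T(\zeta))$, $(\lambda,\zeta)$ is one from $(q,\sigma,\zeta)$ to $(p_A,+_A,0_A)$, $\lambda\ell_A=\lambda T(\lambda)$, and, with $\mu:=\langle\pi_00,\pi_1\lambda\rangle T(\sigma):A_2\to TA$, the square $\mu T(q)=\pi_0q0$ exhibits $A_2$ as the pullback of $T(q)$ along $0_M$, preserved by every $T^k$. A bundle morphism $(f,g)$ from $q:A\to M$ to $q':A'\to M'$ is $f:A\to A'$, $g:M\to M'$ with $fq'=qg$; it is linear if $f\lambda'=\lambda T(f)$. If $f:X\to TA$ satisfies $fT(q)=fpq0$, then $\{f\}:X\to A$ denotes the unique map with $\langle fp,\{f\}\rangle\mu=f$. Differential objects. A differential object is a commutative monoid $(A,\sigma,\zeta)$ with a map $\hat p:TA\to A$ such that $(p,\hat p)$ exhibits $TA$ as $A\times A$, $0\hat p=\,!\zeta$, $+\hat p=\langle\pi_0\hat p,\pi_1\hat p\rangle\sigma$, $T(\sigma)\hat p=(\hat p\times\hat p)\sigma$, $T(\zeta)\hat p=\zeta$, $\ell T(\hat p)\hat p=\hat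 p$. It is a differential bundle over $1$ with lift $\lambda$ determined by $\lambda p=\,!\zeta$, $\lambda\hat p=1_A$. Systems and curve objects. A vector field on $M$ is $V:M\to TM$ with $Vp=1_M$. A dynamical system $(M,V,g)$ is a vector field $V$ on $M$ with $g:1\to M$. Given a dynamical system $(C,c_1,c_0)$, a (parameterized) system $(M,V,g)$ is a vector field $V$ on $M$ with $g:X\to M$; a solution is $\gamma:C\times X\to M$ with $\langle !c_0,1\rangle\gamma=g$ and $(c_1\times 0)T(\gamma)=\gamma V$. A curve object is a dynamical system $(C,c_1,c_0)$ such that every system has at most one solution, $c_1T(c_1)c=c_1T(c_1)$, and $(C,c_1,1_C)$ has a solution. $V$ is complete if $(M,V,1_M)$ has a solution (then every $(M,V,g)$ does). A linear vector field on a differential bundle $q:A\to M$ is a pair of vector fields $V^A$ on $A$, $V^M$ on $M$ with $V^AT(q)=qV^M$ and $\lambda T(V^A)=V^AT(\lambda)c$. A curve object satisfies linear completeness if whenever $(V^A,V^M)$ is a linear vector field on a differential bundle and $V^M$ is complete, then $V^A$ is complete. A differential curve object is a curve object $(C,c_1,c_0)$ satisfying linear completeness with a differential object structure $(\hat p,\sigma,\zeta)$ on $C$ such that $c_0=\zeta$ and $c_1\hat p=\,!u$, where $u:=c_0c_1\hat p:1\to C$. Exponentials and actions. For a differential bundle $q:A\to M$ put $\Delta^A:=\langle1,1\rangle\mu:A\to TA$; $(\Delta^A,0_M)$ is a linear vector field and $E^A:C\times A\to A$ denotes the solution of $(A,\Delta^A,1_A)$. With $\lambda_C$ the lift of $C$,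 the action associated to $A$ is $\gamma^A:=\{(\lambda_C\times 0)T(E^A)\}:C\times A\to A$ (the bracket is defined). *)

(* Defs.v *)
From mathcomp Require Import all_boot.

Set Implicit Arguments.
Unset Strict Implicit.
Unset Printing Implicit Defensive.

(* Composition is diagrammatic: f ;; g is first f, then g. *)
Reserved Notation "A ~> B" (at level 60, no associativity).
Reserved Notation "f ;; g" (at level 50, left associativity).

Record category := Category {
  ob :> Type;
  hom : ob -> ob -> Type where "A ~> B" := (hom A B);
  idm : forall A, A ~> A;
  comp : forall A B D, A ~> B -> B ~> D -> A ~> D
    where "f ;; g" := (comp f g);
  comp1m : forall A B (f : A ~> B), idm A ;; f = f;
  compm1 : forall A B (f : A ~> B), f ;; idm B = f;
  compA : forall A B D E (f : A ~> B) (g : B ~> D) (h : D ~> E),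
    f ;; (g ;; h) = f ;; g ;; h
}.
Arguments idm {c} A.

Notation "A ~> B" := (hom A B).
Notation "f ;; g" := (comp f g).

(* Universal properties are Type-valued: they carry their mediating maps,
   which are unique, so this involves no choice beyond unique choice. *)

Record is_terminal (C : category) (U : C) : Type := IsTerminal {
  bang : forall X, X ~> U;
  bang_uniq : forall X (f g : X ~> U), f = g
}.
Arguments bang {C U} i X.

Record is_product (C : category) (A B P : C) (p0 : P ~> A) (p1 : P ~> B)
    : Type := IsProduct {
  pr_pair : forall X, X ~> A -> X ~> B -> X ~> P;
  pr_pair0 : forall X (a : X ~> A) (b : X ~> B), pr_pair a b ;; p0 = a;
  pr_pair1 : forall X (a : X ~> A) (b : X ~> B), pr_pair a b ;; p1 = b;
  pr_uniq : forall X (u v : X ~> P),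
    u ;; p0 = v ;; p0 -> u ;; p1 = v ;; p1 -> u = v
}.

Record is_pullback (C : category) (A B M P : C) (f : A ~> M) (g : B ~> M)
    (p0 : P ~> A) (p1 : P ~> B) : Type := IsPullback {
  pb_sq : p0 ;; f = p1 ;; g;
  pb_lift : forall X (a : X ~> A) (b : X ~> B), a ;; f = b ;; g -> X ~> P;
  pb_lift0 : forall X (a : X ~> A) (b : X ~> B) (h : a ;; f = b ;; g),
    pb_lift h ;; p0 = a;
  pb_lift1 : forall X (a : X ~> A) (b : X ~> B) (h : a ;; f = b ;; g),
    pb_lift h ;; p1 = b;
  pb_uniq : forall X (u v : X ~> P),
    u ;; p0 = v ;; p0 -> u ;; p1 = v ;; p1 -> u = v
}.

(* (P, r, pi) is the product of n copies of q in the slice over M.  The map r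
   to the base is part of the cone so that n = 0 (where P is M) is covered. *)
Record is_fibre_power (C : category) (A M : C) (q : A ~> M) (n : nat)
    (P : C) (r : P ~> M) (pi : 'I_n -> P ~> A) : Type := IsFibrePower {
  fp_cone : forall i, pi i ;; q = r;
  fp_lift : forall X (x : X ~> M) (a : 'I_n -> X ~> A),
    (forall i, a i ;; q = x) -> X ~> P;
  fp_lift_base : forall X (x : X ~> M) (a : 'I_n -> X ~> A)
    (h : forall i, a i ;; q = x), fp_lift h ;; r = x;
  fp_lift_pi : forall X (x : X ~> M) (a : 'I_n -> X ~> A)
    (h : forall i, a i ;; q = x) i, fp_lift h ;; pi i = a i;
  fp_uniq : forall X (u v : X ~> P),
    u ;; r = v ;; r -> (forall i, u ;; pi i = v ;; pi i) -> u = v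
}.

Record fibre_power (C : category) (A M : C) (q : A ~> M) (n : nat) :=
    FibrePower {
  fp_ob :> C;
  fp_base : fp_ob ~> M;
  fp_pi : 'I_n -> fp_ob ~> A;
  fp_univ :> is_fibre_power q fp_base fp_pi
}.
Arguments fp_pi {C A M q n} f i.

Definition fp0 (C : category) (A M : C) (q : A ~> M) (P : fibre_power q 2)
    : P ~> A := fp_pi P ord0.
Definition fp1 (C : category) (A M : C) (q : A ~> M) (P : fibre_power q 2)
    : P ~> A := fp_pi P ord_max.

Definition tab2 (S : Type) (a b : S) (i : 'I_2) : S :=
  if i == ord0 then a else b.

Lemma tab2_over (C : category) (A M X : C) (q : A ~> M) (a b : X ~> A) :
  a ;; q = b ;; q -> forall i, tab2 a b i ;; q = b ;; q.
Proof. by move=> h i; rewrite /tab2; case: ifP. Qed.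

(* The pairing <a, b> into the binary fibre power. *)
Definition fpair (C : category) (A M : C) (q : A ~> M) (P : fibre_power q 2)
    (X : C) (a b : X ~> A) (h : a ;; q = b ;; q) : X ~> P :=
  fp_lift P (tab2_over h).
Arguments fpair {C A M q} P {X a b} h.

Lemma fpair0 (C : category) (A M : C) (q : A ~> M) (P : fibre_power q 2)
    (X : C) (a b : X ~> A) (h : a ;; q = b ;; q) : fpair P h ;; fp0 P = a.
Proof. by rewrite /fpair /fp0 fp_lift_pi. Qed.

Lemma fpair1 (C : category) (A M : C) (q : A ~> M) (P : fibre_power q 2)
    (X : C) (a b : X ~> A) (h : a ;; q = b ;; q) : fpair P h ;; fp1 P = b.
Proof. by rewrite /fpair /fp1 fp_lift_pi. Qed.

Lemma fp0q (C : category) (A M : C) (q : A ~> M) (P : fibre_power q 2) :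
  fp0 P ;; q = fp_base P.
Proof. exact: (fp_cone P ord0). Qed.

Lemma fp1q (C : category) (A M : C) (q : A ~> M) (P : fibre_power q 2) :
  fp1 P ;; q = fp_base P.
Proof. exact: (fp_cone P ord_max). Qed.

Lemma fp2_uniq (C : category) (A M : C) (q : A ~> M) (P : fibre_power q 2)
    (X : C) (u v : X ~> P) :
  u ;; fp0 P = v ;; fp0 P -> u ;; fp1 P = v ;; fp1 P -> u = v.
Proof.
move=> h0 h1; apply: (fp_uniq P).
  by rewrite -(fp0q P) !compA h0.
move=> i; have [->|->] : i = ord0 \/ i = ord_max by
  case: i => [[|[|k]] hk] //; [left | right]; apply: val_inj.
- exact: h0.
- exact: h1.
Qed.

(* Additive bundles.  add_data is the data only; is_additive_bundle says that
   it is a commutative monoid in the slice over the base.  The monoid laws are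
   stated for generalized elements, with sums a + b := <a, b> sigma. *)
Record add_data (C : category) := AddData {
  ad_tot : C;
  ad_base : C;
  ad_proj : ad_tot ~> ad_base;
  ad_2 : fibre_power ad_proj 2;
  ad_add : ad_2 ~> ad_tot;
  ad_zero : ad_base ~> ad_tot
}.

Definition ad_sum (C : category) (E : add_data C) (X : C)
    (a b : X ~> ad_tot E) (h : a ;; ad_proj E = b ;; ad_proj E)
    : X ~> ad_tot E :=
  fpair (ad_2 E) h ;; ad_add E.
Arguments ad_sum {C} E {X} a b h.

(* Hypotheses such as h1 and h2 in ab_addA are consequences of ab_add_over and
   ab_zero_over; they are quantified over only to be able to write the sums. *)
Record is_additive_bundle (C : category) (E : add_data C) : Prop :=
    IsAdditiveBundle {
  ab_add_over : ad_add E ;; ad_proj E = fp_base (ad_2 E);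
  ab_zero_over : ad_zero E ;; ad_proj E = idm (ad_base E);
  ab_addA : forall X (a b c : X ~> ad_tot E)
    (hab : a ;; ad_proj E = b ;; ad_proj E)
    (hbc : b ;; ad_proj E = c ;; ad_proj E)
    (h1 : ad_sum E a b hab ;; ad_proj E = c ;; ad_proj E)
    (h2 : a ;; ad_proj E = ad_sum E b c hbc ;; ad_proj E),
    ad_sum E (ad_sum E a b hab) c h1 = ad_sum E a (ad_sum E b c hbc) h2;
  ab_addC : forall X (a b : X ~> ad_tot E)
    (h : a ;; ad_proj E = b ;; ad_proj E),
    ad_sum E a b h = ad_sum E b a (esym h);
  ab_add0 : forall X (a : X ~> ad_tot E)
    (h : a ;; ad_proj E = a ;; ad_proj E ;; ad_zero E ;; ad_proj E),
    ad_sum E a (a ;; ad_proj E ;; ad_zero E) h = a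
}.

(* In am_add the hypothesis h follows from am_sq. *)
Record is_additive_morphism (C : category) (E E' : add_data C)
    (f : ad_tot E ~> ad_tot E') (g : ad_base E ~> ad_base E') : Prop :=
    IsAdditiveMorphism {
  am_sq : f ;; ad_proj E' = ad_proj E ;; g;
  am_add : forall h : fp0 (ad_2 E) ;; f ;; ad_proj E'
                    = fp1 (ad_2 E) ;; f ;; ad_proj E',
    ad_add E ;; f = ad_sum E' (fp0 (ad_2 E) ;; f) (fp1 (ad_2 E) ;; f) h;
  am_zero : ad_zero E ;; f = g ;; ad_zero E'
}.

Record endofunctor (C : category) := Endofunctor {
  fob :> C -> C;
  fmap : forall A B : C, A ~> B -> fob A ~> fob B;
  fmap1 : forall A : C, fmap (idm A) = idm (fob A);
  fmapM : forall (A B D : C) (f : A ~> B) (g : B ~> D),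
    fmap (f ;; g) = fmap f ;; fmap g
}.
Arguments fmap {C} e {A B} f.

Fixpoint fmapn (C : category) (T : endofunctor C) (k : nat) (A B : C)
    (f : A ~> B) : iter k T A ~> iter k T B :=
  if k is k'.+1 then fmap T (fmapn T k' f) else f.
Arguments fmapn {C} T k {A B} f.

(* Fibre powers of q of all arities, preserved by every T^k (k = 0 is the
   universal property itself). *)
Record fibre_powers (C : category) (T : endofunctor C) (A M : C) (q : A ~> M)
    := FibrePowers {
  fps_ob : nat -> C;
  fps_base : forall n, fps_ob n ~> M;
  fps_pi : forall n, 'I_n -> fps_ob n ~> A;
  fps_univ : forall n k, is_fibre_power (fmapn T k q)
    (fmapn T k (fps_base n)) (fun i => fmapn T k (fps_pi i))
}.

Definition fps_pow (C : category) (T : endofunctor C) (A M : C) (q : A ~> M)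
    (P : fibre_powers T q) (n : nat) : fibre_power q n :=
  FibrePower (fps_univ P n 0).

Definition fps_Tpow (C : category) (T : endofunctor C) (A M : C) (q : A ~> M)
    (P : fibre_powers T q) (n : nat) : fibre_power (fmap T q) n :=
  FibrePower (fps_univ P n 1).

(* The data of an additive bundle all of whose fibre powers exist and are
   preserved by every T^k. *)
Record bundle_data (C : category) (T : endofunctor C) := BundleData {
  bd_tot : C;
  bd_base : C;
  bd_proj : bd_tot ~> bd_base;
  bd_pow : fibre_powers T bd_proj;
  bd_add : fps_pow bd_pow 2 ~> bd_tot;
  bd_zero : bd_base ~> bd_tot
}.

Definition bd_2 (C : category) (T : endofunctor C) (E : bundle_data T)
    : fibre_power (bd_proj E) 2 := fps_pow (bd_pow E) 2.

Definition add_of (C : category) (T : endofunctor C) (E : bundle_data T)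
    : add_data C := AddData (bd_add E) (bd_zero E).

(* (T(q), T(sigma), T(zeta)), with T(A_2) as binary fibre power of T(q). *)
Definition T_add_of (C : category) (T : endofunctor C) (E : bundle_data T)
    : add_data C :=
  @AddData C (T (bd_tot E)) (T (bd_base E)) (fmap T (bd_proj E))
    (fps_Tpow (bd_pow E) 2) (fmap T (bd_add E)) (fmap T (bd_zero E)).

Record tangent_data := TangentData {
  tg_cat :> category;
  tg_T : endofunctor tg_cat;
  tg_p : forall M : tg_cat, tg_T M ~> M;
  tg_0 : forall M : tg_cat, M ~> tg_T M;
  tg_pow : forall M : tg_cat, fibre_powers tg_T (tg_p M);
  tg_add : forall M : tg_cat, fps_pow (tg_pow M) 2 ~> tg_T M;
  tg_l : forall M : tg_cat, tg_T M ~> tg_T (tg_T M);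
  tg_c : forall M : tg_cat, tg_T (tg_T M) ~> tg_T (tg_T M)
}.

Definition To (X : tangent_data) (M : X) : X := tg_T X M.
Definition Tm (X : tangent_data) (M N : X) (f : M ~> N) : To M ~> To N :=
  fmap (tg_T X) f.
Arguments tg_p {t} M.
Arguments tg_0 {t} M.
Arguments tg_pow {t} M.
Arguments tg_add {t} M.
Arguments tg_l {t} M.
Arguments tg_c {t} M.

Definition tangent_bundle (X : tangent_data) (M : X) : bundle_data (tg_T X) :=
  @BundleData X (tg_T X) (To M) M (tg_p M) (tg_pow M) (tg_add M) (tg_0 M).

Record is_pretangent (X : tangent_data) : Prop := IsPretangent {
  tg_p_nat : forall (M N : X) (f : M ~> N), Tm f ;; tg_p N = tg_p M ;; f;
  tg_0_nat : forall (M N : X) (f : M ~> N), f ;; tg_0 N = tg_0 M ;; Tm f;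
  tg_l_nat : forall (M N : X) (f : M ~> N),
    Tm f ;; tg_l N = tg_l M ;; Tm (Tm f);
  tg_c_nat : forall (M N : X) (f : M ~> N),
    Tm (Tm f) ;; tg_c N = tg_c M ;; Tm (Tm f);
  (* The hypothesis h, with which <pi_0 T(f), pi_1 T(f)> = T_2(f) is formed,
     follows from tg_p_nat. *)
  tg_add_nat : forall (M N : X) (f : M ~> N)
    (h : fp0 (bd_2 (tangent_bundle M)) ;; Tm f ;; tg_p N
       = fp1 (bd_2 (tangent_bundle M)) ;; Tm f ;; tg_p N),
    tg_add M ;; Tm f = fpair (bd_2 (tangent_bundle N)) h ;; tg_add N;
  tg_additive : forall M : X, is_additive_bundle (add_of (tangent_bundle M));
  tg_l_morph : forall M : X, @is_additive_morphism X
    (add_of (tangent_bundle M)) (T_add_of (tangent_bundle M))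
    (tg_l M) (tg_0 M);
  tg_c_morph : forall M : X, @is_additive_morphism X
    (T_add_of (tangent_bundle M)) (add_of (tangent_bundle (To M)))
    (tg_c M) (idm (To M));
  tg_cc : forall M : X, tg_c M ;; tg_c M = idm (To (To M));
  tg_lc : forall M : X, tg_l M ;; tg_c M = tg_l M;
  tg_ll : forall M : X, tg_l M ;; Tm (tg_l M) = tg_l M ;; tg_l (To M);
  tg_ccc : forall M : X,
    Tm (tg_c M) ;; tg_c (To M) ;; Tm (tg_c M)
    = tg_c (To M) ;; Tm (tg_c M) ;; tg_c (To M);
  tg_lcc : forall M : X,
    tg_l (To M) ;; Tm (tg_c M) ;; tg_c (To M) = tg_c M ;; Tm (tg_l M)
}.

Lemma tg_0p (X : tangent_data) (HX : is_pretangent X) (M : X) :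
  tg_0 M ;; tg_p M = idm M.
Proof. exact: (ab_zero_over (tg_additive HX M)). Qed.

Lemma vlift_subproof (X : tangent_data) (HX : is_pretangent X) (M : X) :
  fp0 (bd_2 (tangent_bundle M)) ;; tg_l M ;; Tm (tg_p M)
  = fp1 (bd_2 (tangent_bundle M)) ;; tg_0 (To M) ;; Tm (tg_p M).
Proof.
rewrite -!compA (am_sq (tg_l_morph HX M)) -(tg_0_nat HX) !compA.
by rewrite (fp0q (bd_2 (tangent_bundle M))) (fp1q (bd_2 (tangent_bundle M))).
Qed.

(* v = <pi_0 l, pi_1 0> T(+) *)
Definition vlift (X : tangent_data) (HX : is_pretangent X) (M : X)
    : bd_2 (tangent_bundle M) ~> To (To M) :=
  @ad_sum X (T_add_of (tangent_bundle M)) _ _ _ (vlift_subproof HX M).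

Record tangent_category := TangentCategory {
  tc_data :> tangent_data;
  tc_pretangent : is_pretangent tc_data;
  tc_vlift : forall (M : tc_data) (k : nat), is_pullback
    (fmapn (tg_T tc_data) k (Tm (tg_p M))) (fmapn (tg_T tc_data) k (tg_0 M))
    (fmapn (tg_T tc_data) k (vlift tc_pretangent M))
    (fmapn (tg_T tc_data) k (fp0 (bd_2 (tangent_bundle M)) ;; tg_p M))
}.

Record cartesian_tangent_category := CartesianTangentCategory {
  ct_tan :> tangent_category;
  ct_one : ct_tan;
  ct_one_term : is_terminal ct_one;
  ct_prod : ct_tan -> ct_tan -> ct_tan;
  ct_fst : forall A B : ct_tan, ct_prod A B ~> A;
  ct_snd : forall A B : ct_tan, ct_prod A B ~> B;
  ct_prodP : forall A B : ct_tan, is_product (ct_fst A B) (ct_snd A B);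
  ct_T_one : is_terminal (To ct_one);
  ct_T_prod : forall A B : ct_tan,
    is_product (Tm (ct_fst A B)) (Tm (ct_snd A B))
}.
Arguments ct_fst {c} A B.
Arguments ct_snd {c} A B.

Definition to1 (X : cartesian_tangent_category) (A : X) : A ~> ct_one X :=
  bang (ct_one_term X) A.
Definition pair_ (X : cartesian_tangent_category) (Y A B : X)
    (a : Y ~> A) (b : Y ~> B) : Y ~> ct_prod A B := pr_pair (ct_prodP A B) a b.
Definition cross (X : cartesian_tangent_category) (A B A' B' : X)
    (f : A ~> A') (g : B ~> B') : ct_prod A B ~> ct_prod A' B' :=
  pair_ (ct_fst A B ;; f) (ct_snd A B ;; g).
(* f x g as a map into T(A' x B'), identified with TA' x TB'. *)
Definition Tcross (X : cartesian_tangent_category) (A B A' B' : X)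
    (f : A ~> To A') (g : B ~> To B')
    : ct_prod A B ~> To (ct_prod A' B') :=
  pr_pair (ct_T_prod A' B') (ct_fst A B ;; f) (ct_snd A B ;; g).

Record diff_bundle_data (X : tangent_category) := DiffBundleData {
  db_bundle :> bundle_data (tg_T X);
  db_lift : bd_tot db_bundle ~> To (bd_tot db_bundle)
}.

Record is_prediff_bundle (X : tangent_category) (E : diff_bundle_data X)
    : Prop := IsPrediffBundle {
  db_additive : is_additive_bundle (add_of E);
  db_lift_morph0 : @is_additive_morphism X (add_of E) (T_add_of E)
    (db_lift E) (tg_0 (bd_base E));
  db_lift_morphz : @is_additive_morphism X
    (add_of E) (add_of (tangent_bundle (bd_tot E))) (db_lift E) (bd_zero E);
  db_ll : db_lift E ;; tg_l (bd_tot E) = db_lift E ;; Tm (db_lift E)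
}.

Lemma db_mu_subproof (X : tangent_category) (E : diff_bundle_data X)
    (HE : is_prediff_bundle E) :
  fp0 (bd_2 E) ;; tg_0 (bd_tot E) ;; Tm (bd_proj E)
  = fp1 (bd_2 E) ;; db_lift E ;; Tm (bd_proj E).
Proof.
rewrite -!compA (am_sq (db_lift_morph0 HE)) -(tg_0_nat (tc_pretangent X)).
by rewrite !compA fp0q fp1q.
Qed.

(* mu = <pi_0 0, pi_1 lambda> T(sigma) *)
Definition db_mu (X : tangent_category) (E : diff_bundle_data X)
    (HE : is_prediff_bundle E) : bd_2 E ~> To (bd_tot E) :=
  @ad_sum X (T_add_of E) _ _ _ (db_mu_subproof HE).

Record diff_bundle (X : tangent_category) := DiffBundle {
  db_data :> diff_bundle_data X;
  db_prediff : is_prediff_bundle db_data;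
  db_univ : forall k : nat, is_pullback
    (fmapn (tg_T X) k (Tm (bd_proj db_data)))
    (fmapn (tg_T X) k (tg_0 (bd_base db_data)))
    (fmapn (tg_T X) k (db_mu db_prediff))
    (fmapn (tg_T X) k (fp0 (bd_2 db_data) ;; bd_proj db_data))
}.

Definition mu (X : tangent_category) (A : diff_bundle X)
    : bd_2 A ~> To (bd_tot A) := db_mu (db_prediff A).

Definition bundle_morphism (X : tangent_category) (A B : diff_bundle X)
    (f : bd_tot A ~> bd_tot B) (g : bd_base A ~> bd_base B) : Prop :=
  f ;; bd_proj B = bd_proj A ;; g.

Definition linear (X : tangent_category) (A B : diff_bundle X)
    (f : bd_tot A ~> bd_tot B) : Prop :=
  f ;; db_lift B = db_lift A ;; Tm f.

(* {f} is the second component of the factorization of f through mu; by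
   bracketP and bracket_uniq it is the unique map with <f p, {f}> mu = f. *)
Definition bracket (X : tangent_category) (A : diff_bundle X) (Y : X)
    (f : Y ~> To (bd_tot A))
    (h : f ;; Tm (bd_proj A)
       = f ;; tg_p (bd_tot A) ;; bd_proj A ;; tg_0 (bd_base A))
    : Y ~> bd_tot A :=
  pb_lift (db_univ A 0) h ;; fp1 (bd_2 A).

Lemma mu_p (X : tangent_category) (A : diff_bundle X) :
  mu A ;; tg_p (bd_tot A) = fp0 (bd_2 A).
Proof.
have HX := tc_pretangent X; pose HA := db_prediff A.
have nat0 : fmap (tg_T X) (bd_add A) ;; tg_p (bd_tot A)
          = tg_p _ ;; bd_add A := tg_p_nat HX (bd_add A).
rewrite /mu /db_mu /ad_sum /= -compA nat0 compA.
set w := fpair _ _.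
have w0 : w ;; Tm (fp0 (bd_2 A)) = fp0 (bd_2 A) ;; tg_0 (bd_tot A)
  := fpair0 (fps_Tpow (bd_pow A) 2) (db_mu_subproof HA).
have w1 : w ;; Tm (fp1 (bd_2 A)) = fp1 (bd_2 A) ;; db_lift A
  := fpair1 (fps_Tpow (bd_pow A) 2) (db_mu_subproof HA).
have lp : db_lift A ;; tg_p (bd_tot A) = bd_proj A ;; bd_zero A
  := am_sq (db_lift_morphz HA).
have zq : bd_zero A ;; bd_proj A = idm _ := ab_zero_over (db_additive HA).
have h : fp0 (bd_2 A) ;; bd_proj A
       = fp0 (bd_2 A) ;; bd_proj A ;; bd_zero A ;; bd_proj A.
  by rewrite -!compA zq compm1.
rewrite -[RHS](ab_add0 (db_additive HA) h) /ad_sum /=; congr (_ ;; _).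
apply: (@fp2_uniq _ _ _ _ (bd_2 A)).
  apply: etrans _ (esym (fpair0 (bd_2 A) h)).
  by rewrite -compA -(tg_p_nat HX) compA w0 -compA (tg_0p HX) compm1.
apply: etrans _ (esym (fpair1 (bd_2 A) h)).
rewrite -[LHS]compA -(tg_p_nat HX) [LHS]compA w1 -[LHS]compA lp [LHS]compA.
by rewrite (fp1q (bd_2 A)) (fp0q (bd_2 A)).
Qed.

Lemma bracketP (X : tangent_category) (A : diff_bundle X) (Y : X)
    (f : Y ~> To (bd_tot A))
    (h : f ;; Tm (bd_proj A)
       = f ;; tg_p (bd_tot A) ;; bd_proj A ;; tg_0 (bd_base A)) :
  exists hq : f ;; tg_p (bd_tot A) ;; bd_proj A = bracket h ;; bd_proj A,
    fpair (bd_2 A) hq ;; mu A = f.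
Proof.
set u := pb_lift (db_univ A 0) h.
have um : u ;; mu A = f by exact: (pb_lift0 (db_univ A 0)).
have uE : bracket h = u ;; fp1 (bd_2 A) by [].
clearbody u.
have u0 : u ;; fp0 (bd_2 A) = f ;; tg_p (bd_tot A) by rewrite -mu_p compA um.
have hq : f ;; tg_p (bd_tot A) ;; bd_proj A = bracket h ;; bd_proj A.
  by rewrite -u0 uE -!compA fp0q fp1q.
exists hq; rewrite -[RHS]um; congr (_ ;; _).
by apply: (@fp2_uniq _ _ _ _ (bd_2 A)); rewrite ?fpair0 ?fpair1.
Qed.

Lemma bracket_uniq (X : tangent_category) (A : diff_bundle X) (Y : X)
    (f : Y ~> To (bd_tot A))
    (h : f ;; Tm (bd_proj A)
       = f ;; tg_p (bd_tot A) ;; bd_proj A ;; tg_0 (bd_base A))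
    (b : Y ~> bd_tot A)
    (hq : f ;; tg_p (bd_tot A) ;; bd_proj A = b ;; bd_proj A) :
  fpair (bd_2 A) hq ;; mu A = f -> b = bracket h.
Proof.
move=> hb; rewrite -(fpair1 (bd_2 A) hq) /bracket; congr (_ ;; _).
apply: (pb_uniq (db_univ A 0)); rewrite /=.
  rewrite (pb_lift0 (db_univ A 0)); exact: hb.
rewrite (pb_lift1 (db_univ A 0)) /=.
exact: etrans (compA _ _ _)
  (congr1 (fun x => x ;; bd_proj A) (fpair0 (bd_2 A) hq)).
Qed.

Definition is_vector_field (X : tangent_category) (M : X) (V : M ~> To M)
    : Prop := V ;; tg_p M = idm M.

Definition is_linear_vf (X : tangent_category) (A : diff_bundle X)
    (VA : bd_tot A ~> To (bd_tot A)) (VM : bd_base A ~> To (bd_base A))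
    : Prop :=
  [/\ is_vector_field VA, is_vector_field VM,
      VA ;; Tm (bd_proj A) = bd_proj A ;; VM &
      db_lift A ;; Tm VA = VA ;; Tm (db_lift A) ;; tg_c (bd_tot A)].

(* g is a solution of the parameterized system (M, V, g : Y -> M). *)
Definition is_solution (X : cartesian_tangent_category) (C : X)
    (c1 : C ~> To C) (c0 : ct_one X ~> C) (M Y : X) (V : M ~> To M)
    (g : Y ~> M) (gamma : ct_prod C Y ~> M) : Prop :=
  pair_ (to1 Y ;; c0) (idm Y) ;; gamma = g /\
  Tcross c1 (tg_0 Y) ;; Tm gamma = gamma ;; V.

(* Solutions are unique in a curve object, so that a solution can be carried
   as data. *)
Definition has_solution (X : cartesian_tangent_category) (C : X)
    (c1 : C ~> To C) (c0 : ct_one X ~> C) (M Y : X) (V : M ~> To M)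
    (g : Y ~> M) : Type :=
  {gamma : ct_prod C Y ~> M | is_solution c1 c0 V g gamma}.

Record curve_object (X : cartesian_tangent_category) := CurveObject {
  cv_ob :> X;
  cv_1 : cv_ob ~> To cv_ob;
  cv_0 : ct_one X ~> cv_ob;
  cv_vf : is_vector_field cv_1;
  cv_uniq : forall (M Y : X) (V : M ~> To M) (g : Y ~> M)
    (gamma gamma' : ct_prod cv_ob Y ~> M), is_vector_field V ->
    is_solution cv_1 cv_0 V g gamma -> is_solution cv_1 cv_0 V g gamma' ->
    gamma = gamma';
  cv_comm : cv_1 ;; Tm cv_1 ;; tg_c cv_ob = cv_1 ;; Tm cv_1;
  cv_sol : has_solution cv_1 cv_0 cv_1 (idm cv_ob)
}.

Definition complete (X : cartesian_tangent_category) (C : curve_object X)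
    (M : X) (V : M ~> To M) : Type :=
  has_solution (cv_1 C) (cv_0 C) V (idm M).

Definition linearly_complete (X : cartesian_tangent_category)
    (C : curve_object X) : Type :=
  forall (A : diff_bundle X) (VA : bd_tot A ~> To (bd_tot A))
    (VM : bd_base A ~> To (bd_base A)),
    is_linear_vf VA VM -> complete C VM -> complete C VA.

(* Differential object structure on A.  In do_T_zero the map T(zeta) has
   domain T(1), identified with 1. *)
Record diff_object (X : cartesian_tangent_category) (A : X) := DiffObject {
  do_add : ct_prod A A ~> A;
  do_zero : ct_one X ~> A;
  do_phat : To A ~> A;
  do_addA : forall (Y : X) (a b c : Y ~> A),
    pair_ (pair_ a b ;; do_add) c ;; do_add
    = pair_ a (pair_ b c ;; do_add) ;; do_add;
  do_addC : forall (Y : X) (a b : Y ~> A),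
    pair_ a b ;; do_add = pair_ b a ;; do_add;
  do_add0 : forall (Y : X) (a : Y ~> A),
    pair_ a (to1 Y ;; do_zero) ;; do_add = a;
  do_prod : is_product (tg_p A) do_phat;
  do_0_phat : tg_0 A ;; do_phat = to1 A ;; do_zero;
  do_plus_phat : tg_add A ;; do_phat
    = pair_ (fp0 (bd_2 (tangent_bundle A)) ;; do_phat)
            (fp1 (bd_2 (tangent_bundle A)) ;; do_phat) ;; do_add;
  do_T_add : Tm do_add ;; do_phat
    = pair_ (Tm (ct_fst A A) ;; do_phat) (Tm (ct_snd A A) ;; do_phat)
      ;; do_add;
  do_T_zero : Tm do_zero ;; do_phat = to1 (To (ct_one X)) ;; do_zero;
  do_l_phat : tg_l A ;; Tm do_phat ;; do_phat = do_phat
}.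

(* The lift with lambda p = ! zeta and lambda phat = 1. *)
Definition do_lift (X : cartesian_tangent_category) (A : X)
    (D : diff_object A) : A ~> To A :=
  pr_pair (do_prod D) (to1 A ;; do_zero D) (idm A).

Record diff_curve_object (X : cartesian_tangent_category) :=
    DiffCurveObject {
  dc_curve :> curve_object X;
  dc_linear_complete : linearly_complete dc_curve;
  dc_diff : diff_object dc_curve;
  dc_zero : cv_0 dc_curve = do_zero dc_diff;
  dc_one : cv_1 dc_curve ;; do_phat dc_diff
    = to1 dc_curve ;; (cv_0 dc_curve ;; cv_1 dc_curve ;; do_phat dc_diff)
}.

(* Delta^A = <1, 1> mu *)
Definition Delta (X : tangent_category) (A : diff_bundle X)
    : bd_tot A ~> To (bd_tot A) :=
  fpair (bd_2 A) (erefl (idm (bd_tot A) ;; bd_proj A)) ;; mu A.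

Lemma Delta_proj (X : tangent_category) (A : diff_bundle X) :
  Delta A ;; Tm (bd_proj A) = bd_proj A ;; tg_0 (bd_base A).
Proof.
have sq : mu A ;; Tm (bd_proj A)
        = fp0 (bd_2 A) ;; bd_proj A ;; tg_0 (bd_base A)
  := pb_sq (db_univ A 0).
by rewrite /Delta -compA sq !compA fpair0 comp1m.
Qed.

Lemma tg_0c (X : tangent_data) (HX : is_pretangent X) (M : X) :
  tg_0 (To M) ;; tg_c M = Tm (tg_0 M).
Proof.
have z : Tm (tg_0 M) ;; tg_c M = idm (To M) ;; tg_0 (To M)
  := am_zero (tg_c_morph HX M).
by rewrite -[tg_0 (To M)]comp1m -z -compA (tg_cc HX) compm1.
Qed.

Lemma TmM (X : tangent_data) (M N P : X) (f : M ~> N) (g : N ~> P) :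
  Tm (f ;; g) = Tm f ;; Tm g.
Proof. exact: fmapM. Qed.

Lemma Delta_linear (X : tangent_category) (A : diff_bundle X) :
  is_linear_vf (Delta A) (tg_0 (bd_base A)).
Proof.
have HX := tc_pretangent X; pose HA := db_prediff A.
have lq := am_sq (db_lift_morph0 HA); rewrite /= in lq.
split.
- by rewrite /is_vector_field /Delta -compA mu_p fpair0.
- exact: tg_0p.
- exact: Delta_proj.
pose w : bd_tot A ~> To (bd_2 A) :=
  fpair (bd_2 A) (erefl (idm (bd_tot A) ;; bd_proj A))
  ;; fpair (fps_Tpow (bd_pow A) 2) (db_mu_subproof HA).
have DE : Delta A = w ;; Tm (bd_add A) by exact: compA.
have w0 : w ;; Tm (fp0 (bd_2 A)) = tg_0 (bd_tot A).
  rewrite /w -compA.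
  rewrite (fpair0 (fps_Tpow (bd_pow A) 2) (db_mu_subproof HA)).
  by rewrite compA fpair0 comp1m.
have w1 : w ;; Tm (fp1 (bd_2 A)) = db_lift A.
  rewrite /w -compA.
  rewrite (fpair1 (fps_Tpow (bd_pow A) 2) (db_mu_subproof HA)).
  by rewrite compA fpair1 comp1m.
have h : fp0 (bd_2 A) ;; db_lift A ;; Tm (bd_proj A)
       = fp1 (bd_2 A) ;; db_lift A ;; Tm (bd_proj A).
  by rewrite -!compA lq !compA fp0q fp1q.
pose l2 : bd_2 A ~> To (bd_2 A) := fpair (fps_Tpow (bd_pow A) 2) h.
have sl : bd_add A ;; db_lift A = l2 ;; Tm (bd_add A)
  := am_add (db_lift_morph0 HA) h.
have l20 : l2 ;; Tm (fp0 (bd_2 A)) = fp0 (bd_2 A) ;; db_lift A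
  := fpair0 (fps_Tpow (bd_pow A) 2) h.
have l21 : l2 ;; Tm (fp1 (bd_2 A)) = fp1 (bd_2 A) ;; db_lift A
  := fpair1 (fps_Tpow (bd_pow A) 2) h.
clearbody w l2.
have R : w ;; Tm (bd_add A) ;; Tm (db_lift A) ;; tg_c (bd_tot A)
       = w ;; Tm l2 ;; tg_c _ ;; Tm (Tm (bd_add A)).
  rewrite -[w ;; _ ;; _]compA -TmM sl TmM compA.
  by rewrite -compA (tg_c_nat HX) compA.
rewrite DE R TmM compA; congr (_ ;; _).
set P2 := FibrePower (fps_univ (bd_pow A) 2 2).
have E0 : fp0 P2 = Tm (Tm (fp0 (bd_2 A))) by [].
have E1 : fp1 P2 = Tm (Tm (fp1 (bd_2 A))) by [].
apply: (@fp2_uniq _ _ _ _ P2); rewrite ?E0 ?E1.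
  rewrite -[LHS]compA -TmM w0 -[RHS]compA -(tg_c_nat HX).
  rewrite compA -[_ ;; _ ;; Tm (Tm _)]compA -TmM l20 TmM compA w0.
  by rewrite -(tg_0_nat HX) -compA (tg_0c HX).
rewrite -[LHS]compA -TmM w1 -[RHS]compA -(tg_c_nat HX).
rewrite compA -[_ ;; _ ;; Tm (Tm _)]compA -TmM l21 TmM compA w1.
by rewrite -(db_ll HA) -compA (tg_lc HX).
Qed.

Lemma Tcross_fst (X : cartesian_tangent_category) (A B A' B' : X)
    (f : A ~> To A') (g : B ~> To B') :
  Tcross f g ;; Tm (ct_fst A' B') = ct_fst A B ;; f.
Proof. exact: pr_pair0. Qed.

Lemma Tcross_snd (X : cartesian_tangent_category) (A B A' B' : X)
    (f : A ~> To A') (g : B ~> To B') :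
  Tcross f g ;; Tm (ct_snd A' B') = ct_snd A B ;; g.
Proof. exact: pr_pair1. Qed.

Lemma zero_solution (X : cartesian_tangent_category) (C : curve_object X)
    (M Y : X) (g : Y ~> M) :
  is_solution (cv_1 C) (cv_0 C) (tg_0 M) g (ct_snd C Y ;; g).
Proof.
split; first by rewrite compA (pr_pair1 (ct_prodP C Y)) comp1m.
by rewrite TmM compA Tcross_snd -!compA (tg_0_nat (tc_pretangent X)).
Qed.

Definition zero_complete (X : cartesian_tangent_category)
    (C : curve_object X) (M : X) : complete C (tg_0 M) :=
  exist _ _ (zero_solution C (idm M)).

(* E^A, the solution of (A, Delta^A, 1_A). *)
Definition exponential (X : cartesian_tangent_category)
    (C : diff_curve_object X) (A : diff_bundle X)
    : ct_prod C (bd_tot A) ~> bd_tot A :=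
  sval (@dc_linear_complete X C A _ _ (Delta_linear A)
          (zero_complete C (bd_base A))).

Lemma exponentialP (X : cartesian_tangent_category)
    (C : diff_curve_object X) (A : diff_bundle X) :
  is_solution (cv_1 C) (cv_0 C) (Delta A) (idm (bd_tot A)) (exponential C A).
Proof. exact: svalP. Qed.

Lemma exponential_proj (X : cartesian_tangent_category)
    (C : diff_curve_object X) (A : diff_bundle X) :
  exponential C A ;; bd_proj A = ct_snd C (bd_tot A) ;; bd_proj A.
Proof.
have HX := tc_pretangent X.
apply: (@cv_uniq X C _ _ (tg_0 (bd_base A)) (bd_proj A)).
- exact: tg_0p.
- have [e0 e1] := exponentialP C A; split.
    by rewrite compA e0 comp1m.
  by rewrite TmM compA e1 -[LHS]compA Delta_proj compA.
- exact: zero_solution.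
Qed.

Lemma action_subproof (X : cartesian_tangent_category)
    (C : diff_curve_object X) (A : diff_bundle X) :
  let f := Tcross (do_lift (dc_diff C)) (tg_0 (bd_tot A))
           ;; Tm (exponential C A) in
  f ;; Tm (bd_proj A)
  = f ;; tg_p (bd_tot A) ;; bd_proj A ;; tg_0 (bd_base A).
Proof.
have HX := tc_pretangent X; move=> f.
have fq : f ;; Tm (bd_proj A)
        = ct_snd C (bd_tot A) ;; bd_proj A ;; tg_0 (bd_base A).
  rewrite /f -compA -TmM exponential_proj TmM compA Tcross_snd.
  by rewrite -!compA (tg_0_nat HX).
rewrite -[f ;; _ ;; bd_proj A]compA -(tg_p_nat HX) [f ;; (_ ;; _)]compA fq.
by rewrite -[_ ;; tg_0 _ ;; tg_p _]compA (tg_0p HX) compm1.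
Qed.

(* gamma^A = {(lambda_C x 0) T(E^A)} *)
Definition action (X : cartesian_tangent_category) (C : diff_curve_object X)
    (A : diff_bundle X) : ct_prod C (bd_tot A) ~> bd_tot A :=
  bracket (action_subproof C A).

(* Main.v *)
From mathcomp Require Import all_boot.
Require Import Defs.

Set Implicit Arguments.
Unset Strict Implicit.
Unset Printing Implicit Defensive.

(** For c in C and a in A write c . a for the action.  The map
    (lambda_C x 0) T(E^A) is the derivative of E^A at time zero in the
    direction c, so that, with E^A(0, a) = a, the defining property of the
    bracket reads (lambda_C x 0) T(E^A) = <a, c . a> mu.

    Suppose that f is linear.  Since the lift of a differential bundle is monic
    ([db_lift_inj]), f is additive ([linear_additive]); hence it commutes with
    mu ([mu_linear]) and with the vector field Delta ([Delta_morph]).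
    Uniqueness of solutions shows that f commutes with the exponentials
    ([exponential_morph]), and by differentiating this and cancelling the monic
    mu one sees that f commutes with the actions ([linear_action]).

    Conversely, the lift of A can be recovered from its action, because of two
    facts.
    - The unit u of C acts as the identity ([unit_action]): the lift of C sends
      u to c_0 c_1, so the differential equation of E^A at time zero says that
      the derivative in the direction u is Delta = <a, a> mu.
    - The action is linear in c ([action_lift]), that is
      (lambda_C x 0) T(gamma^A) = gamma^A lambda.  Each side is the second
      component of a map into T(A_2) whose first component is pi_1 0, so it
      suffices to compare these two maps after T(mu) ([T_mu_inj]).  There they
      are two expressions for the second derivative of E^A, equal because
      lambda_C l = lambda_C T(lambda_C) ([do_lift_l]), 0 l = 0 T(0) and
      lambda l = lambda T(lambda).
    Therefore lambda(a) = T(gamma^A)(lambda_C u, 0 a), and a map which commutes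
    with the actions commutes with the right-hand side, so it is linear
    ([action_linear]). *)

(** * Products and the tangent functor *)

Lemma tg_lp (X : tangent_data) (HX : is_pretangent X) (M : X) :
  tg_l M ;; tg_p (To M) = tg_p M ;; tg_0 M.
Proof.
have lT : tg_l M ;; Tm (tg_p M) = tg_p M ;; tg_0 M := am_sq (tg_l_morph HX M).
have cp : tg_c M ;; tg_p (To M) = Tm (tg_p M) ;; idm _
  := am_sq (tg_c_morph HX M).
by rewrite -lT -(tg_lc HX) -compA cp compm1 (tg_lc HX).
Qed.

Lemma tg_0l (X : tangent_data) (HX : is_pretangent X) (M : X) :
  tg_0 M ;; tg_l M = tg_0 M ;; Tm (tg_0 M).
Proof. exact: (am_zero (tg_l_morph HX M)). Qed.

Section Products.

Variable X : cartesian_tangent_category.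
Implicit Types Y A B : X.

Lemma pair_fst Y A B (a : Y ~> A) (b : Y ~> B) :
  pair_ a b ;; ct_fst A B = a.
Proof. exact: pr_pair0. Qed.

Lemma pair_snd Y A B (a : Y ~> A) (b : Y ~> B) :
  pair_ a b ;; ct_snd A B = b.
Proof. exact: pr_pair1. Qed.

Lemma cross_fst A B A' B' (f : A ~> A') (g : B ~> B') :
  cross f g ;; ct_fst A' B' = ct_fst A B ;; f.
Proof. exact: pair_fst. Qed.

Lemma cross_snd A B A' B' (f : A ~> A') (g : B ~> B') :
  cross f g ;; ct_snd A' B' = ct_snd A B ;; g.
Proof. exact: pair_snd. Qed.

Lemma prod_uniq Y A B (u v : Y ~> ct_prod A B) :
  u ;; ct_fst A B = v ;; ct_fst A B -> u ;; ct_snd A B = v ;; ct_snd A B ->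
  u = v.
Proof. exact: (pr_uniq (ct_prodP A B)). Qed.

Lemma T_prod_uniq Y A B (u v : Y ~> To (ct_prod A B)) :
  u ;; Tm (ct_fst A B) = v ;; Tm (ct_fst A B) ->
  u ;; Tm (ct_snd A B) = v ;; Tm (ct_snd A B) -> u = v.
Proof. exact: (pr_uniq (ct_T_prod A B)). Qed.

(** T preserves every product cone, as far as uniqueness is concerned: such a
    cone is isomorphic to the chosen one. *)
Lemma T_product_uniq (A B P : X) (p0 : P ~> A) (p1 : P ~> B) (Y : X)
    (u v : Y ~> To P) : is_product p0 p1 ->
  u ;; Tm p0 = v ;; Tm p0 -> u ;; Tm p1 = v ;; Tm p1 -> u = v.
Proof.
move=> HP h0 h1.
pose i : P ~> ct_prod A B := pair_ p0 p1.
pose j : ct_prod A B ~> P := pr_pair HP (ct_fst A B) (ct_snd A B).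
have ij : i ;; j = idm _.
  apply: (pr_uniq HP); rewrite comp1m -compA.
    by rewrite (pr_pair0 HP) pair_fst.
  by rewrite (pr_pair1 HP) pair_snd.
have Tij : Tm i ;; Tm j = idm _ by rewrite -TmM ij; apply: fmap1.
rewrite -[u]compm1 -[v]compm1 -Tij !compA; congr (_ ;; _).
by apply: T_prod_uniq; rewrite -!compA -TmM ?pair_fst ?pair_snd.
Qed.

Lemma to1_uniq Y (u v : Y ~> ct_one X) : u = v.
Proof. exact: (bang_uniq (ct_one_term X)). Qed.

Lemma pair_point_cross B B' (A : X) (a : ct_one X ~> A) (f : B ~> B') :
  pair_ (to1 B ;; a) (idm B) ;; cross (idm A) f
  = f ;; pair_ (to1 B' ;; a) (idm B').
Proof.
apply: prod_uniq.
  rewrite -[LHS]compA cross_fst compA pair_fst compm1 -[RHS]compA pair_fst.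
  by rewrite compA; congr (_ ;; _); apply: to1_uniq.
rewrite -[LHS]compA cross_snd compA pair_snd comp1m -[RHS]compA pair_snd.
by rewrite compm1.
Qed.

Lemma cross_Tcross A A' B B' (a : A ~> To A') (f : B ~> B') :
  cross (idm A) f ;; Tcross a (tg_0 B')
  = Tcross a (tg_0 B) ;; Tm (cross (idm A') f).
Proof.
have HX := tc_pretangent X; apply: T_prod_uniq.
  rewrite -compA Tcross_fst compA cross_fst compm1 -[RHS]compA -TmM cross_fst.
  by rewrite compm1 Tcross_fst.
rewrite -compA Tcross_snd compA cross_snd -[RHS]compA -TmM cross_snd TmM.
by rewrite [RHS]compA Tcross_snd -!compA (tg_0_nat HX).
Qed.

Lemma Tcross_p A A' B (a : A ~> To A') :
  Tcross a (tg_0 B) ;; tg_p (ct_prod A' B)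
  = cross (a ;; tg_p A') (idm B).
Proof.
have HX := tc_pretangent X; apply: prod_uniq.
  by rewrite -compA -(tg_p_nat HX) compA Tcross_fst cross_fst -compA.
by rewrite -compA -(tg_p_nat HX) compA Tcross_snd cross_snd -compA (tg_0p HX).
Qed.

End Products.

(** * Differential objects *)

Section DiffObject.

Variables (X : cartesian_tangent_category) (A : X) (D : diff_object A).

Lemma do_lift_p : do_lift D ;; tg_p A = to1 A ;; do_zero D.
Proof. exact: pr_pair0. Qed.

Lemma do_lift_phat : do_lift D ;; do_phat D = idm A.
Proof. exact: pr_pair1. Qed.

Lemma do_uniq (Y : X) (u v : Y ~> To A) :
  u ;; tg_p A = v ;; tg_p A -> u ;; do_phat D = v ;; do_phat D -> u = v.
Proof. exact: (pr_uniq (do_prod D)). Qed.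

Lemma T_do_uniq (Y : X) (u v : Y ~> To (To A)) :
  u ;; Tm (tg_p A) = v ;; Tm (tg_p A) ->
  u ;; Tm (do_phat D) = v ;; Tm (do_phat D) -> u = v.
Proof. exact: (T_product_uniq (do_prod D)). Qed.

(** The axiom lambda l = lambda T(lambda) of the differential bundle A over the
    terminal object. *)
Lemma do_lift_l : do_lift D ;; tg_l A = do_lift D ;; Tm (do_lift D).
Proof.
have HX := tc_pretangent X.
have lT : tg_l A ;; Tm (tg_p A) = tg_p A ;; tg_0 A := am_sq (tg_l_morph HX A).
apply: T_do_uniq.
  rewrite -[LHS]compA lT compA do_lift_p.
  rewrite -[RHS]compA -TmM do_lift_p -compA (tg_0_nat HX) TmM !compA.
  by congr (_ ;; _); apply: (bang_uniq (ct_T_one X)).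
rewrite -[RHS]compA -TmM do_lift_phat.
rewrite (_ : Tm (idm A) = idm _) ?compm1; last exact: fmap1.
apply: do_uniq.
  rewrite -[LHS]compA (tg_p_nat HX) -compA [tg_l A ;; _]compA (tg_lp HX).
  rewrite -!compA do_0_phat [tg_p A ;; _]compA compA.
  by rewrite do_lift_p; congr (_ ;; _); apply: to1_uniq.
by rewrite -!compA [tg_l A ;; _]compA do_l_phat.
Qed.

End DiffObject.

(** * Differential bundles and linear morphisms *)

Section DiffBundle.

Variable X : tangent_category.
Implicit Types A B : diff_bundle X.

(** mu = <pi_0 0, pi_1 lambda> T(sigma), with the pairing m into T(A_2) given by
    its two components. *)
Lemma mu_decomp A : exists m : bd_2 A ~> To (bd_2 A),
  [/\ mu A = m ;; Tm (bd_add A),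
      m ;; Tm (fp0 (bd_2 A)) = fp0 (bd_2 A) ;; tg_0 (bd_tot A) &
      m ;; Tm (fp1 (bd_2 A)) = fp1 (bd_2 A) ;; db_lift A].
Proof.
exists (fpair (fps_Tpow (bd_pow A) 2) (db_mu_subproof (db_prediff A))).
split=> //.
- exact: (fpair0 (fps_Tpow (bd_pow A) 2)).
- exact: (fpair1 (fps_Tpow (bd_pow A) 2)).
Qed.

Lemma T2_uniq A (Y : X) (u v : Y ~> To (bd_2 A)) :
  u ;; Tm (fp0 (bd_2 A)) = v ;; Tm (fp0 (bd_2 A)) ->
  u ;; Tm (fp1 (bd_2 A)) = v ;; Tm (fp1 (bd_2 A)) -> u = v.
Proof. exact: (@fp2_uniq _ _ _ _ (fps_Tpow (bd_pow A) 2)). Qed.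

Lemma TT2_uniq A (Y : X) (u v : Y ~> To (To (bd_2 A))) :
  u ;; Tm (Tm (fp0 (bd_2 A))) = v ;; Tm (Tm (fp0 (bd_2 A))) ->
  u ;; Tm (Tm (fp1 (bd_2 A))) = v ;; Tm (Tm (fp1 (bd_2 A))) -> u = v.
Proof.
exact: (@fp2_uniq _ _ _ _ (FibrePower (fps_univ (bd_pow A) 2 2))).
Qed.

Lemma mu_inj A (Y : X) (u v : Y ~> bd_2 A) : u ;; mu A = v ;; mu A -> u = v.
Proof.
move=> h; apply: (pb_uniq (db_univ A 0)); first exact: h.
have h0 : u ;; fp0 (bd_2 A) = v ;; fp0 (bd_2 A).
  by rewrite -(mu_p A) [LHS]compA [RHS]compA h.
change (u ;; (fp0 (bd_2 A) ;; bd_proj A) = v ;; (fp0 (bd_2 A) ;; bd_proj A)).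
by rewrite !compA h0.
Qed.

(** T(mu) reflects equality of pairs with equal first components. *)
Lemma T_mu_inj A (Y : X) (u v : Y ~> To (bd_2 A)) :
  u ;; Tm (fp0 (bd_2 A)) = v ;; Tm (fp0 (bd_2 A)) ->
  u ;; Tm (mu A) = v ;; Tm (mu A) -> u = v.
Proof.
move=> h0 h; apply: (pb_uniq (db_univ A 1)); first exact: h.
have E : fmapn (tg_T X) 1 (fp0 (bd_2 A) ;; bd_proj A)
  = Tm (fp0 (bd_2 A)) ;; Tm (bd_proj A) by exact: TmM.
by rewrite E !compA h0.
Qed.

Lemma db_lift_proj A :
  db_lift A ;; Tm (bd_proj A) = bd_proj A ;; tg_0 (bd_base A).
Proof. exact: (am_sq (db_lift_morph0 (db_prediff A))). Qed.

(** lambda = <q zeta, 1> mu, since lambda = 0 + lambda in the fibres of T(q). *)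
Lemma lift_mu A : exists z : bd_tot A ~> bd_2 A,
  z ;; fp1 (bd_2 A) = idm _ /\ z ;; mu A = db_lift A.
Proof.
have HX := tc_pretangent X; have HA := db_additive (db_prediff A).
have zq : bd_zero A ;; bd_proj A = idm _ := ab_zero_over HA.
have h : idm _ ;; bd_proj A
       = idm _ ;; bd_proj A ;; bd_zero A ;; bd_proj A.
  by rewrite -[RHS]compA zq compm1.
pose z := fpair (bd_2 A) (esym h).
have zadd : z ;; bd_add A = idm _.
  by have := ab_add0 HA h; rewrite (ab_addC HA).
have z0 : z ;; fp0 (bd_2 A) = bd_proj A ;; bd_zero A.
  by rewrite /z fpair0 comp1m.
have z1 : z ;; fp1 (bd_2 A) = idm _ by exact: fpair1.
have [m [mE m0 m1]] := mu_decomp A.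
exists z; split=> //; rewrite mE compA.
(* The zero of T(q) is T(zeta), so the pairing defining mu, taken at
   <q zeta, 1>, is itself an instance of T(<q zeta, 1>). *)
have -> : z ;; m = db_lift A ;; Tm z.
  apply: T2_uniq; rewrite -!compA -!TmM ?m0 ?m1.
    rewrite z0 compA z0 TmM [RHS]compA db_lift_proj -!compA.
    by rewrite (tg_0_nat HX).
  rewrite compA z1 comp1m (_ : Tm (idm _) = idm _) ?compm1 //; exact: fmap1.
by rewrite -compA -TmM zadd (_ : Tm (idm _) = idm _) ?compm1 //; exact: fmap1.
Qed.

Lemma db_lift_inj A (Y : X) (u v : Y ~> bd_tot A) :
  u ;; db_lift A = v ;; db_lift A -> u = v.
Proof.
have [z [z1 zm]] := lift_mu A; rewrite -zm (compA u) (compA v) => /mu_inj h.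
by rewrite -[u]compm1 -[v]compm1 -z1 !compA h.
Qed.

Section Morphism.

Variables (A B : diff_bundle X).
Variables (f : bd_tot A ~> bd_tot B) (g : bd_base A ~> bd_base B).
Hypotheses (hfg : bundle_morphism f g) (hf : linear f).

Lemma pow2_over :
  fp0 (bd_2 A) ;; f ;; bd_proj B = fp1 (bd_2 A) ;; f ;; bd_proj B.
Proof. by rewrite -!compA hfg !compA fp0q fp1q. Qed.

(** The map f_2 induced by a bundle morphism (f, g) on binary fibre powers. *)
Definition pow2 : bd_2 A ~> bd_2 B := fpair (bd_2 B) pow2_over.

(** Followed by the lift of B, both sides become the sum of pi_0 lambda T(f) and
    pi_1 lambda T(f) in the tangent bundle of B. *)
Lemma linear_additive : bd_add A ;; f = pow2 ;; bd_add B.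
Proof.
have HX := tc_pretangent X.
have over (E : diff_bundle X) :
    fp0 (bd_2 E) ;; db_lift E ;; tg_p _ = fp1 (bd_2 E) ;; db_lift E ;; tg_p _.
  have lp : db_lift E ;; tg_p _ = bd_proj E ;; bd_zero E
    := am_sq (db_lift_morphz (db_prediff E)).
  by rewrite -!compA lp !compA fp0q fp1q.
have add (E : diff_bundle X) : bd_add E ;; db_lift E
    = fpair (bd_2 (tangent_bundle (bd_tot E))) (over E) ;; tg_add _
  := am_add (db_lift_morphz (db_prediff E)) (over E).
apply: db_lift_inj; rewrite -compA hf compA add -compA.
have h : fp0 (bd_2 (tangent_bundle (bd_tot A))) ;; Tm f ;; tg_p (bd_tot B)
       = fp1 (bd_2 (tangent_bundle (bd_tot A))) ;; Tm f ;; tg_p (bd_tot B).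
  by rewrite -!compA (tg_p_nat HX) !compA (fp0q (bd_2 (tangent_bundle _)))
    (fp1q (bd_2 (tangent_bundle _))).
rewrite (tg_add_nat HX h) -[RHS]compA add !compA; congr (_ ;; _).
apply: (@fp2_uniq _ _ _ _ (bd_2 (tangent_bundle (bd_tot B)))).
  rewrite -[LHS]compA -[RHS]compA !fpair0 !compA !fpair0.
  by rewrite -!compA hf.
rewrite -[LHS]compA -[RHS]compA !fpair1 !compA !fpair1.
by rewrite -!compA hf.
Qed.

Lemma mu_linear : mu A ;; Tm f = pow2 ;; mu B.
Proof.
have HX := tc_pretangent X.
have [mA [-> mA0 mA1]] := mu_decomp A; have [mB [-> mB0 mB1]] := mu_decomp B.
rewrite -compA -TmM linear_additive TmM !compA; congr (_ ;; _).
apply: T2_uniq.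
  rewrite -[LHS]compA -TmM fpair0 TmM compA mA0 -[RHS]compA mB0 compA fpair0.
  by rewrite -!compA (tg_0_nat HX).
rewrite -[LHS]compA -TmM fpair1 TmM compA mA1 -[RHS]compA mB1 compA fpair1.
by rewrite -!compA hf.
Qed.

Lemma Delta_morph : Delta A ;; Tm f = f ;; Delta B.
Proof.
rewrite /Delta -compA mu_linear (compA f) [LHS]compA; congr (_ ;; _).
apply: (@fp2_uniq _ _ _ _ (bd_2 B)); rewrite -!compA ?fpair0 ?fpair1.
  by rewrite compA fpair0 comp1m compm1.
by rewrite compA fpair1 comp1m compm1.
Qed.

End Morphism.

End DiffBundle.

(** * Exponentials and actions *)

Section Action.

Variables (X : cartesian_tangent_category) (C : diff_curve_object X).
Implicit Types A B : diff_bundle X.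

(** The derivative of the exponential at time zero; the action is its
    bracket. *)
Definition dexp A : ct_prod C (bd_tot A) ~> To (bd_tot A) :=
  Tcross (do_lift (dc_diff C)) (tg_0 (bd_tot A)) ;; Tm (exponential C A).

Lemma dexp_p A : dexp A ;; tg_p (bd_tot A) = ct_snd C (bd_tot A).
Proof.
have HX := tc_pretangent X; have [e0 _] := exponentialP C A.
rewrite /dexp -compA (tg_p_nat HX) compA Tcross_p do_lift_p -dc_zero.
rewrite (_ : cross _ _ = ct_snd _ _ ;; pair_ (to1 _ ;; cv_0 C) (idm _)).
  by rewrite -compA e0 compm1.
apply: prod_uniq.
  rewrite cross_fst -[RHS]compA pair_fst !compA; congr (_ ;; _).
  exact: to1_uniq.
by rewrite cross_snd -[RHS]compA pair_snd.
Qed.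

Lemma dexp_mu A : exists w : ct_prod C (bd_tot A) ~> bd_2 A,
  [/\ w ;; fp0 (bd_2 A) = ct_snd C (bd_tot A),
      w ;; fp1 (bd_2 A) = action C A & w ;; mu A = dexp A].
Proof.
have [hq E] := bracketP (action_subproof C A).
exists (fpair (bd_2 A) hq); split=> //; last by rewrite fpair1.
by rewrite fpair0; apply: dexp_p.
Qed.

Lemma exponential_morph A B f g :
  @bundle_morphism X A B f g -> linear f ->
  exponential C A ;; f = cross (idm (cv_ob C)) f ;; exponential C B.
Proof.
move=> hfg hf; have [a0 a1] := exponentialP C A.
have [b0 b1] := exponentialP C B.
apply: (@cv_uniq X C _ _ (Delta B) f).
- by have [] := Delta_linear B.
- split; first by rewrite compA a0 comp1m.
  by rewrite TmM compA a1 -[LHS]compA -[RHS]compA (Delta_morph hfg hf).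
- split; first by rewrite compA pair_point_cross -compA b0 compm1.
  by rewrite TmM compA -cross_Tcross -[LHS]compA b1 [LHS]compA.
Qed.

Lemma linear_action A B f g :
  @bundle_morphism X A B f g -> linear f ->
  action C A ;; f = cross (idm (cv_ob C)) f ;; action C B.
Proof.
move=> hfg hf.
have [wA [_ <- wAm]] := dexp_mu A; have [wB [_ <- wBm]] := dexp_mu B.
have F1 : pow2 hfg ;; fp1 (bd_2 B) = fp1 (bd_2 A) ;; f by exact: fpair1.
rewrite -[LHS]compA -F1 !compA; congr (_ ;; _); apply: mu_inj.
rewrite -[LHS]compA -(mu_linear hfg hf) compA wAm -[RHS]compA wBm /dexp.
rewrite -compA -TmM (exponential_morph hfg hf) TmM.
by rewrite !compA cross_Tcross.
Qed.

(** The unit u = c_0 c_1 phat of C. *)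
Definition cv_unit : ct_one X ~> C :=
  cv_0 C ;; cv_1 C ;; do_phat (dc_diff C).

(** The tangent vector c_0 c_1 at zero is the vertical lift of u. *)
Lemma cv_unit_lift : cv_unit ;; do_lift (dc_diff C) = cv_0 C ;; cv_1 C.
Proof.
apply: (do_uniq (D := dc_diff C)).
  rewrite -compA do_lift_p -[RHS]compA.
  have -> : cv_1 C ;; tg_p C = idm _ := cv_vf C.
  rewrite compm1 compA dc_zero -[RHS]comp1m; congr (_ ;; _).
  exact: to1_uniq.
by rewrite -[LHS]compA do_lift_phat compm1.
Qed.

(** u . a = a. *)
Lemma unit_action A :
  pair_ (to1 _ ;; cv_unit) (idm (bd_tot A)) ;; action C A = idm (bd_tot A).
Proof.
have [w [_ <- wm]] := dexp_mu A; have [e0 e1] := exponentialP C A.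
set u := pair_ _ _.
have uw : u ;; w = fpair (bd_2 A) (erefl (idm (bd_tot A) ;; bd_proj A)).
  apply: mu_inj; rewrite -compA wm -/(Delta A) /dexp -[RHS]comp1m -e0.
  rewrite -[RHS]compA -e1 !compA; congr (_ ;; _); apply: T_prod_uniq.
    rewrite -[LHS]compA -[RHS]compA !Tcross_fst [LHS]compA [RHS]compA.
    by rewrite !pair_fst -[LHS]compA cv_unit_lift -[RHS]compA.
  rewrite -[LHS]compA -[RHS]compA !Tcross_snd [LHS]compA [RHS]compA.
  by rewrite !pair_snd.
by rewrite compA uw fpair1.
Qed.

(** The action is linear in the scalar. *)
Lemma action_lift A :
  Tcross (do_lift (dc_diff C)) (tg_0 (bd_tot A)) ;; Tm (action C A)
  = action C A ;; db_lift A.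
Proof.
have HX := tc_pretangent X.
have [w [w0 <- wm]] := dexp_mu A; have [m [mE m0 m1]] := mu_decomp A.
set k := Tcross _ _.
(* The pair <snd 0, gamma lambda>, through which the second derivative of E^A
   factors as zT T(mu). *)
pose zT := w ;; m.
have zT0 : zT ;; Tm (fp0 (bd_2 A)) = w ;; fp0 (bd_2 A) ;; tg_0 _.
  by rewrite /zT -!compA m0.
have zT1 : zT ;; Tm (fp1 (bd_2 A)) = w ;; fp1 (bd_2 A) ;; db_lift A.
  by rewrite /zT -!compA m1.
have k2 : k ;; Tm k = k ;; tg_l _.
  apply: (T_product_uniq (ct_T_prod (cv_ob C) (bd_tot A))).
    rewrite -!compA -TmM -(tg_l_nat HX) Tcross_fst TmM [LHS]compA [RHS]compA.
    by rewrite !Tcross_fst -!compA do_lift_l.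
  rewrite -!compA -TmM -(tg_l_nat HX) Tcross_snd TmM [LHS]compA [RHS]compA.
  by rewrite !Tcross_snd -!compA (tg_0l HX).
have m_l : zT ;; tg_l _ = zT ;; Tm m.
  apply: TT2_uniq.
    rewrite -[LHS]compA -[RHS]compA -(tg_l_nat HX) -TmM m0 TmM.
    by rewrite [LHS]compA [RHS]compA zT0 -!compA (tg_0l HX).
  rewrite -[LHS]compA -[RHS]compA -(tg_l_nat HX) -TmM m1 TmM.
  by rewrite [LHS]compA [RHS]compA zT1 -!compA (db_ll (db_prediff A)).
have E : k ;; Tm w = zT.
  apply: T_mu_inj; first by rewrite zT0 w0 -compA -TmM w0 Tcross_snd.
  rewrite -compA -TmM wm /dexp -/k TmM compA k2 -compA -(tg_l_nat HX).
  rewrite [LHS]compA -/(dexp A) -wm mE TmM [RHS]compA -m_l /zT.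
  by rewrite -!compA (tg_l_nat HX).
by rewrite TmM compA E zT1.
Qed.

Lemma action_linear A B (f : bd_tot A ~> bd_tot B) :
  action C A ;; f = cross (idm (cv_ob C)) f ;; action C B -> linear f.
Proof.
move=> hf; rewrite /linear -[db_lift A]comp1m -[db_lift B]comp1m.
rewrite -(unit_action A) -(unit_action B) -(compA _ (action C A)).
rewrite -(compA _ (action C B)) -!action_lift (compA f) -pair_point_cross.
rewrite -[LHS]compA -[RHS]compA -(compA _ _ (Tm f)) -TmM hf TmM.
by rewrite (compA (cross _ _)) cross_Tcross -[in LHS]compA.
Qed.

End Action.

Theorem proposition5p40 (X : cartesian_tangent_category)
    (C : diff_curve_object X) (A B : diff_bundle X)
    (f : bd_tot A ~> bd_tot B) (g : bd_base A ~> bd_base B)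
    (hfg : bundle_morphism f g) :
  linear f <->
  action C A ;; f = cross (idm (cv_ob C)) f ;; action C B.
Proof.
split; [exact: linear_action hfg | exact: action_linear].
Qed.
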